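(* Let $\mathcal{T}_n$ be the set of Erdős–Szekeres tableaux of size $n$. Then $|\mathcal{T}_n|=n^{n(1-o(1))}$ as $n\to\infty$; that is, there is a sequence $\varepsilon_n\to 0$ with $|\mathcal{T}_n|=n^{n(1-\varepsilon_n)}$.
   Context: For a sequence $A=(a_1,\dots,a_n)$ of distinct real numbers, $a_i^+$ (resp. $a_i^-$) is the length of the longest increasing (resp. decreasing) subsequence of $A$ ending at $a_i$; the Erdős–Szekeres tableau of $A$ is the sequence $T(A)=((a_i^+,a_i^-))_{i\le n}$ of points, and $\mathcal{T}_n$ is the set of all such sequences for sequences $A$ of length $n$. *)

(* Defs.v *)
From mathcomp Require Import all_boot all_order all_algebra finmap.
From mathcomp Require Import all_classical all_reals all_analysis.

Set Implicit Arguments.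
Unset Strict Implicit.
Unset Printing Implicit Defensive.

Import Order.TTheory GRing.Theory Num.Theory.
Local Open Scope classical_set_scope.
Local Open Scope ring_scope.

(* A sequence of length n is a function a : 'I_n -> R; a subsequence is given
   by its set S of positions, and its length is #|S|. *)

Definition ends_at (n : nat) (S : {set 'I_n}) (i : 'I_n) : bool :=
  (i \in S) && [forall j in S, (j <= i)%N].

Definition increasing_on (R : realType) (n : nat) (a : 'I_n -> R)
    (S : {set 'I_n}) : bool :=
  [forall j in S, forall k in S, (j < k)%N ==> (a j < a k)].

Definition decreasing_on (R : realType) (n : nat) (a : 'I_n -> R)
    (S : {set 'I_n}) : bool :=
  [forall j in S, forall k in S, (j < k)%N ==> (a k < a j)].

Definition lis_ending (R : realType) (n : nat) (a : 'I_n -> R) (i : 'I_n) : nat :=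
  (\max_(S : {set 'I_n} | increasing_on a S && ends_at S i) #|S|)%N.

Definition lds_ending (R : realType) (n : nat) (a : 'I_n -> R) (i : 'I_n) : nat :=
  (\max_(S : {set 'I_n} | decreasing_on a S && ends_at S i) #|S|)%N.

Definition ES_tableau (R : realType) (n : nat) (a : 'I_n -> R) :
    {ffun 'I_n -> nat * nat} :=
  [ffun i => (lis_ending a i, lds_ending a i)].

Definition ES_tableaux (R : realType) (n : nat) : set {ffun 'I_n -> nat * nat} :=
  [set ES_tableau a | a in [set a : 'I_n -> R | injective a]].

(* [fset_set] is only meaningful on finite sets. *)
Lemma finite_ES_tableaux (R : realType) (n : nat) :
  finite_set (@ES_tableaux R n).
Proof.
pose f (g : {ffun 'I_n -> 'I_n.+1 * 'I_n.+1}) : {ffun 'I_n -> nat * nat} :=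
  [ffun i => (nat_of_ord (g i).1, nat_of_ord (g i).2)].
apply: (@sub_finite_set _ _ (f @` [set: {ffun 'I_n -> 'I_n.+1 * 'I_n.+1}])).
  move=> _ [a _ <-].
  have bound (P : pred {set 'I_n}) : (\max_(S | P S) #|S| < n.+1)%N.
    by rewrite ltnS; apply/bigmax_leqP => S _; rewrite -[leqRHS]card_ord max_card.
  exists [ffun i => (Ordinal (bound (fun S => increasing_on a S && ends_at S i)),
                     Ordinal (bound (fun S => decreasing_on a S && ends_at S i)))] => //.
  by apply/ffunP => i; rewrite !ffunE.
by apply: finite_image; exact: finite_finset.
Qed.

Definition num_ES_tableaux (R : realType) (n : nat) : nat :=
  #|` fset_set (@ES_tableaux R n)|%fset.

(* Main.v *)
Require Import Defs.
From mathcomp Require Import all_boot all_order all_algebra finmap.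
From mathcomp Require Import all_classical all_reals all_analysis.
From mathcomp Require Import zify ring lra.

Set Implicit Arguments.
Unset Strict Implicit.
Unset Printing Implicit Defensive.

Import Order.TTheory GRing.Theory Num.Theory numFieldNormedType.Exports.
Local Open Scope classical_set_scope.
Local Open Scope ring_scope.

(** The tableau depends only on the relative order of the entries, so there are
    at most [n ^ n] tableaux.  For the lower bound, start with an increasing
    sequence of length [m] and put each of the remaining [n - m] entries just
    below an arbitrary entry of it, entries placed at the same spot being
    decreasing.  An entry placed below the [c]-th initial one (counting from 0)
    has [a_i^+ = c + 1], so all [m ^ (n - m)] choices give distinct tableaux.
    Taking [m = n / K] and letting first [n] and then [K] grow gives the claim. *)

Lemma card_le_fset_set (F : finType) (U : choiceType) (A : set U) (f : F -> U) :
  finite_set A -> injective f -> (forall x, A (f x)) ->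
  (#|F| <= #|` fset_set A|%fset)%N.
Proof.
move=> finA injf Af; rewrite -(size_codom f); apply: uniq_leq_size.
  by rewrite /codom map_inj_uniq // enum_uniq.
by move=> _ /codomP[x ->]; rewrite in_fset_set // inE.
Qed.

Lemma card_ge_fset_set (F : finType) (U : choiceType) (A : set U) (f : F -> U) :
  finite_set A -> A `<=` range f -> (#|` fset_set A|%fset <= #|F|)%N.
Proof.
move=> finA Af; rewrite -(size_codom f); apply: uniq_leq_size.
  exact: fset_uniq.
by move=> y; rewrite in_fset_set // inE => /Af[x _ <-]; exact: codom_f.
Qed.

Lemma ES_tableau_order (R : realType) n (a b : 'I_n -> R) :
  (forall i j, (a i < a j) = (b i < b j)) -> ES_tableau a = ES_tableau b.
Proof.
move=> ab; apply/ffunP => i; rewrite !ffunE; congr (_, _); apply: eq_bigl => S;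
  congr (_ && _); apply: eq_forallb => j; congr (_ ==> _);
  by apply: eq_forallb => k; rewrite ab.
Qed.

(** Replacing each entry by its rank, the number of smaller entries, keeps the order, so every
    tableau comes from a map ['I_n -> 'I_n]. *)
Lemma num_ES_tableaux_le (R : realType) n : (num_ES_tableaux R n <= n ^ n)%N.
Proof.
rewrite -[X in (X ^ _)%N]card_ord -[X in (_ ^ X)%N]card_ord -card_ffun.
apply: (card_ge_fset_set (f := fun r : {ffun 'I_n -> 'I_n} =>
  ES_tableau (fun i => (r i)%:R : R))); first exact: finite_ES_tableaux.
move=> _ [a _ <-].
pose below i := [set j | a j < a i]%SET.
have below_lt i : (#|below i| < n)%N.
  rewrite -[X in (_ < X)%N]card_ord -cardsT; apply: proper_card.
  by apply/properP; split; [exact: finset.subsetT | exists i; rewrite !inE ?ltxx].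
exists [ffun i => Ordinal (below_lt i)] => //.
apply: ES_tableau_order => i j; rewrite !ffunE /= ltr_nat.
have [lt_ij|le_ji] := ltP (a i) (a j).
  apply: proper_card; apply/properP; split.
    by apply/fintype.subsetP => k; rewrite !inE => /lt_trans; apply.
  by exists i; rewrite !inE ?ltxx.
apply/negbTE; rewrite -leqNgt; apply: subset_leq_card.
by apply/fintype.subsetP => k; rewrite !inE => /lt_le_trans; apply.
Qed.

Section Insertions.
Variables (R : realType) (m k : nat).
Implicit Types (w : {ffun 'I_k -> 'I_m}) (i j : 'I_(m + k)).

Definition level w i : nat :=
  match fintype.split i with inl b => b | inr j => w j end.

(* With [N = m + k], the initial entry [c] has value [c N + N - 1], and an entry
   inserted at position [i] just below it has value [c N + N - 1 - i]. *)
Definition height w i : nat :=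
  (level w i * (m + k) + ((m + k).-1 - (if i < m then 0 else i)))%N.

Definition insertion_seq w i : R := (height w i)%:R.

Lemma level_base w i : (i < m)%N -> level w i = i.
Proof. by rewrite /level; case: fintype.splitP => // j ->; lia. Qed.

Lemma level_lt w i : (level w i < m)%N.
Proof. by rewrite /level; case: fintype.splitP => j _. Qed.

Lemma level_rshift w (j : 'I_k) : level w (rshift m j) = w j.
Proof.
by rewrite /level -[rshift m j]/(unsplit (inr j)) unsplitK.
Qed.

(** The second summand of [height] is below [m + k], so [level] is the quotient of [height] by
    [m + k]. *)
Lemma height_ltW w i j : (height w i < height w j)%N -> (level w i <= level w j)%N.
Proof. by move: (ltn_ord i) (ltn_ord j); rewrite /height; nia. Qed.

Lemma level_ltW w i j : (level w i < level w j)%N -> (height w i < height w j)%N.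
Proof. by move: (ltn_ord i) (ltn_ord j); rewrite /height; nia. Qed.

(** Within one level the initial entry comes first and is highest, and the inserted ones decrease
    with position; an ascent must therefore change level. *)
Lemma height_lt_level w i j :
  (i < j)%N -> (height w i < height w j)%N -> (level w i < level w j)%N.
Proof.
move=> ij hij; have := height_ltW hij; rewrite leq_eqVlt => /predU1P[eq_l|//].
move: hij (ltn_ord i) (ltn_ord j); rewrite /height eq_l ltn_add2l.
have [jm|mj] := ltnP j m; have [im|mi] := ltnP i m; try lia.
Qed.

Lemma insertion_seq_inj w : injective (insertion_seq w).
Proof.
move=> i j /eqP; rewrite eqr_nat => /eqP hij; apply: val_inj => /=.
have eq_l : level w i = level w j.
  have [/level_ltW|/level_ltW|//] := ltngtP (level w i) (level w j);
    by rewrite hij ltnn.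
(* [level_lt] yields [0 < m], so an inserted position, being at least [m], cannot share the offset 0
   of an initial entry. *)
move: hij (level_lt w i) (ltn_ord i) (ltn_ord j); rewrite /height eq_l.
move=> /addnI.
have [im|mi] := ltnP i m; have [jm|mj] := ltnP j m; try lia.
by move: eq_l; rewrite !level_base.
Qed.

(** Upper bound: along an increasing subsequence ending at [i] the levels are distinct and at most
    [level w i]. Lower bound: the first [level w i] initial entries followed by [i] form such a
    subsequence. *)
Lemma lis_insertion_seq w i :
  lis_ending (insertion_seq w) i = (level w i).+1.
Proof.
apply/eqP; rewrite eqn_leq; apply/andP; split.
  apply/bigmax_leqP => S /andP[incS /andP[iS /forallP endS]].
  have leS j : j \in S -> (level w j < (level w i).+1)%N.
    move=> jS; have /implyP/(_ jS) := endS j; rewrite leq_eqVlt => /predU1P[|ji].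
      by move=> /val_inj ->.
    have /forallP/(_ j)/implyP/(_ jS)/forallP/(_ i) := incS.
    by rewrite iS ji /= ltr_nat => /height_ltW.
  pose f j : 'I_(level w i).+1 := inord (level w j).
  rewrite -[X in (_ <= X)%N]card_ord -(@card_in_imset _ _ f S) ?max_card //.
  move=> j1 j2 j1S j2S /(congr1 val); rewrite /= !inordK ?leS // => eq_l.
  have inc j j' : j \in S -> j' \in S -> (j < j')%N -> (level w j < level w j')%N.
    move=> jS j'S jj'; apply: height_lt_level => //; move: incS.
    move=> /forallP/(_ j)/implyP/(_ jS)/forallP/(_ j').
    by rewrite j'S jj' /= ltr_nat.
  apply: val_inj => /=; have [lt12|lt21|//] := ltngtP j1 j2.
    by have := inc _ _ j1S j2S lt12; rewrite eq_l ltnn.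
  by have := inc _ _ j2S j1S lt21; rewrite eq_l ltnn.
(* Hence the initial entries of lower level all precede position [i]. *)
have le_li : (level w i <= i)%N.
  by have [im|mi] := ltnP i m; [rewrite level_base | have := level_lt w i; lia].
have lm := level_lt w i.
pose S : {set 'I_(m + k)} := [set j : 'I_(m + k) | (j < level w i)%N || (j == i)]%SET.
have levelS j : j \in S -> j != i -> (j < level w i)%N /\ level w j = j.
  rewrite inE => /orP[jl _|/eqP-> /eqP//].
  by split=> //; rewrite level_base //; lia.
have -> : (level w i).+1 = #|S|.
  have lmk : (level w i <= m + k)%N by lia.
  have -> : S = (i |: [set widen_ord lmk j | j : 'I_(level w i)])%SET.
    apply/setP => j; rewrite !inE orbC; congr (_ || _).
    apply/idP/imsetP => [jl|[j' _ ->]]; last exact: (ltn_ord j').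
    by exists (Ordinal jl) => //; apply: val_inj.
  rewrite cardsU1 card_imset ?card_ord.
    suff -> : i \notin [set widen_ord lmk j | j : 'I_(level w i)]%SET by [].
    by apply/imsetP => -[j' _ /(congr1 val) /= ij]; have := ltn_ord j'; lia.
  by move=> j1 j2 /(congr1 val) /= /val_inj.
apply: (@leq_bigmax_cond _ _ (fun S : {set 'I_(m + k)} => #|S|)).
apply/andP; split.
  apply/forallP => j; apply/implyP => jS; apply/forallP => j'.
  apply/implyP => j'S; apply/implyP => jj'; rewrite ltr_nat.
  have ji : j != i.
    apply: contraL jj' => /eqP ->; rewrite -leqNgt.
    by have [->//|/(levelS _ j'S)[]] := eqVneq j' i; lia.
  have [jl eq_lj] := levelS j jS ji; apply: level_ltW; rewrite eq_lj.
  have [->//|/(levelS _ j'S)[_ ->//]] := eqVneq j' i.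
apply/andP; split; first by rewrite inE eqxx orbT.
apply/forallP => j; apply/implyP => jS.
by have [->//|/(levelS _ jS)[]] := eqVneq j i; lia.
Qed.

Lemma num_ES_tableaux_ge : (m ^ k <= num_ES_tableaux R (m + k))%N.
Proof.
rewrite -[X in (X ^ _)%N]card_ord -[X in (_ ^ X)%N]card_ord -card_ffun.
apply: (card_le_fset_set (f := fun w => ES_tableau (insertion_seq w))).
- exact: finite_ES_tableaux.
- move=> w1 w2 /ffunP eqT; apply/ffunP => j; apply: val_inj => /=.
  move: (eqT (rshift m j)); rewrite !ffunE !lis_insertion_seq.
  by rewrite !level_rshift => -[].
- by move=> w; exists (insertion_seq w) => //; exact: insertion_seq_inj.
Qed.

End Insertions.

Lemma num_ES_tableaux_gt0 (R : realType) n : (0 < num_ES_tableaux R n)%N.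
Proof.
case: n => [|n]; first exact: (num_ES_tableaux_ge R 0 0).
by rewrite (leq_trans _ (num_ES_tableaux_ge R 1 n)) // exp1n.
Qed.

Lemma ln_num_ES_tableaux_le (R : realType) n :
  ln (num_ES_tableaux R n)%:R <= n%:R * ln n%:R :> R.
Proof.
case: n => [|n]; last first.
  rewrite mulr_natl -lnXn ?ltr0n // -natrX ler_ln ?posrE ?ltr0n ?expn_gt0 //.
    by rewrite ler_nat num_ES_tableaux_le.
  exact: num_ES_tableaux_gt0.
(* For [n = 0] the two bounds force the count to be [0 ^ 0 = 1], whose logarithm is 0. *)
have := num_ES_tableaux_le R 0; have := num_ES_tableaux_gt0 R 0.
by rewrite mul0r; case: num_ES_tableaux => [|[|]] //; rewrite ln1.
Qed.

(** With [m = n %/ K] there are at least [n (1 - 1/K)] insertions, and [n < (m + 1) K <= 2 m K]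
    bounds [m] below by [n / (2 K)]; the factor 2 absorbs the rounding. *)
Lemma ln_num_ES_tableaux_ge (R : realType) K n :
  (0 < K)%N -> (K.*2 <= n)%N ->
  n%:R * (1 - K%:R^-1) * (ln n%:R - ln K.*2%:R) <= ln (num_ES_tableaux R n)%:R :> R.
Proof.
move=> K0 Kn; pose m := (n %/ K)%N.
have mK : (m * K <= n)%N := leq_divM n K.
have Km : (n < m.+1 * K)%N by rewrite -ltn_divLR.
have m0 : (0 < m)%N by rewrite divn_gt0 //; lia.
have mn : (m <= n)%N by nia.
have n0 : (0 < n)%N by lia.
have le_m : ln n%:R - ln K.*2%:R <= ln m%:R :> R.
  rewrite lerBlDr -lnM ?posrE ?ltr0n ?double_gt0 // -natrM.
  rewrite ler_ln ?posrE ?ltr0n ?muln_gt0 ?m0 ?double_gt0 // ler_nat; nia.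
have le_nm : n%:R * (1 - K%:R^-1) <= (n - m)%:R :> R.
  rewrite natrB // mulrBr mulr1 lerD2l lerN2 ler_pdivlMr ?ltr0n //.
  by rewrite -natrM ler_nat.
apply: (@le_trans _ _ ((n - m)%:R * ln m%:R)).
  apply: ler_pM => //.
    rewrite mulr_ge0 // subr_ge0 invf_le1 ?ltr0n //.
    by rewrite (ler_nat R 1).
  by rewrite subr_ge0 ler_ln ?posrE ?ltr0n ?double_gt0 // ler_nat.
rewrite mulr_natl -lnXn ?ltr0n // -natrX ler_ln ?posrE ?ltr0n ?expn_gt0 ?m0 //.
  by rewrite ler_nat; have := num_ES_tableaux_ge R m (n - m); rewrite subnKC.
exact: num_ES_tableaux_gt0.
Qed.

Theorem theorem5 (R : realType) :
  exists eps : nat -> R,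
    (eps n @[n --> \oo] --> (0 : R)) /\
    (forall n : nat,
       (num_ES_tableaux R n)%:R = (n%:R : R) `^ (n%:R * (1 - eps n))).
Proof.
pose T n : R := (num_ES_tableaux R n)%:R.
have T0 n : 0 < T n by rewrite ltr0n num_ES_tableaux_gt0.
(* This [eps] solves the required identity for [n >= 2], where [ln n] is nonzero. *)
exists (fun n => 1 - ln (T n) / (n%:R * ln n%:R)); split; last first.
  move=> n; rewrite opprB addrC subrK -/(T n).
  have [n2|] := leqP 2 n.
    have n0 : 0 < n%:R :> R by rewrite ltr0n; lia.
    have ln0 : 0 < ln n%:R :> R by rewrite ln_gt0 // ltr1n.
    rewrite /powR gt_eqF // -[LHS]lnK ?posrE //; congr expR; field.
    by rewrite !gt_eqF.
  (* For [n <= 1] the count is 1, and the power is 1 whatever [eps] is: the exponent is 0 or the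
     base is 1. *)
  have := num_ES_tableaux_le R n; have := num_ES_tableaux_gt0 R n; rewrite /T.
  case: n => [|[|//]]; case: num_ES_tableaux => [|[|]] // _ _ _.
    by rewrite mul0r powRr0.
  by rewrite powR1.
apply/cvgrPdist_le => e e0.
(* The error splits in two: this [K] makes [1/K] at most [e / 2], and then a large [n] makes
   [ln (2 K)] at most [e / 2 * ln n]. *)
pose K := (Num.truncn (2 / e)).+1.
have K0 : 0 < K%:R :> R by rewrite ltr0n.
have Ke : K%:R^-1 <= e / 2.
  by rewrite -[e / 2]invrK invf_div lef_pV2 ?posrE ?divr_gt0 // ltW // truncnS_gt.
near=> n.
have n2 : (2 <= n)%N by near: n; exact: nbhs_infty_ge.
have Kn : (K.*2 <= n)%N by near: n; exact: nbhs_infty_ge.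
have n0 : 0 < n%:R :> R by rewrite ltr0n; lia.
have l0 : 0 < ln n%:R :> R by rewrite ln_gt0 // ltr1n.
have nl0 : 0 < n%:R * ln n%:R :> R by rewrite mulr_gt0.
have small : ln K.*2%:R <= e / 2 * ln n%:R :> R.
  rewrite -ler_pdivrMl ?divr_gt0 // -ler_expR lnK ?posrE //.
  by near: n; exact: nbhs_infty_ger.
have upper := ln_num_ES_tableaux_le R n.
have lower := ln_num_ES_tableaux_ge R (ltn0Sn _ : (0 < K)%N) Kn.
(* The upper bound on the count says exactly that [eps n] is nonnegative. *)
rewrite sub0r normrN ger0_norm; last first.
  by rewrite subr_ge0 ler_pdivrMr // mul1r.
rewrite lerBlDr -lerBlDl ler_pdivlMr // (le_trans _ lower) //.
rewrite [leLHS]mulrCA -mulrA ler_pM2l //.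
have lK0 : 0 <= ln K.*2%:R :> R by rewrite ln_ge0 // (ler_nat R 1).
have iK0 : 0 < K%:R^-1 :> R by rewrite invr_gt0.
(* Expanding [(1 - 1/K) (ln n - ln (2 K))] loses at most [ln n / K + ln (2 K)] from [ln n], hence at
   most [e * ln n]. *)
nra.
Unshelve. all: by end_near.
Qed.
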